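(* Let $f$ be an arbitrary deterministic mechanism for the $n$-agent single-facility location game on the real line with doubly-peaked preferences (public locations, private preferred distances bounded by $B$) that is universally truthful (strategy-proof). Then the additive approximation error of $f$ is at least $\frac{nB}{24}$. That is, for any given such $f$ there exists a worst-case instance $I$ (with $n$ agents) such that $$SC(f(I),I)\;\ge\; OPT(I)+\frac{nB}{24}.$$
   Context: There is a set $N=\{1,\dots,n\}$ of $n$ agents and a constant $B$ bounding preferred distances. An instance is a tuple $I=\langle (x_1,b_1),\dots,(x_n,b_n)\rangle$, where $x_i\in\mathbb{R}$ is the fixed, publicly known location of agent $i$ and $b_i$, with $0\le b_i\le B$, is its private preferred distance to the facility. The cost of agent $i$ when the facility is at $y\in\mathbb{R}$ is $cost(y,(x_i,b_i))=|x_i-b_i-y|$ if $y\le x_i$ and $|x_i+b_i-y|$ if $y>x_i$. The social cost is $SC(y,I)=\sum_{i=1}^n cost(y,(x_i,b_i))$, and $OPT(I)=\min_{y\in\mathbb{R}}SC(y,I)$. A deterministic mechanism is a function $f:(\mathbb{R}\times\mathbb{R})^n\to\mathbb{R}$ mapping each instance to a facility location. It is strategy-proof (universally truthful) if for every instance $I$, every agent $i$ and every misreport $b_i'\in\mathbb{R}$, $cost(f(I),(x_i,b_i))\le cost(f(I'),(x_i,b_i))$, where $I'$ is $I$ with $(x_i,b_i)$ replaced by $(x_i,b_i')$. The additive approximation error of $f$ is $\sup_I\big[SC(f(I),I)-OPT(I)\big]$, the supremum being over instances with $n$ agents.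
   Formalization: The formal theorem assumes at least three agents. For n = 1 or 2 and B > 0 the claim is false: let agent 1 fix the candidates x_1 - b_1 and x_1 + b_1 and the last agent pick its favourite; this is strategy-proof and attains OPT on every instance. *)

(* Defs.v *)
From HB Require Import structures.
From mathcomp Require Import all_boot all_order all_algebra.
From mathcomp Require Import all_classical all_reals all_analysis.
From mathcomp Require Import ring lra.

Set Implicit Arguments.
Unset Strict Implicit.
Unset Printing Implicit Defensive.

Import Order.TTheory GRing.Theory Num.Theory.
Import numFieldNormedType.Exports.

Local Open Scope classical_set_scope.
Local Open Scope ring_scope.

(* A profile lists the pairs (x_i, b_i) of location and preferred distance.
   The bound 0 <= b_i <= B is the separate predicate [is_instance], since
   mechanisms are defined, and misreports range, over all real b_i. *)
Definition profile (R : realType) (n : nat) := {ffun 'I_n -> R * R}.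

Definition is_instance (R : realType) (n : nat) (B : R) (I : profile R n) :=
  forall i, 0 <= (I i).2 <= B.

Definition cost (R : realType) (y : R) (a : R * R) : R :=
  if y <= a.1 then `|a.1 - a.2 - y| else `|a.1 + a.2 - y|.

Definition SC (R : realType) (n : nat) (y : R) (I : profile R n) : R :=
  \sum_(i < n) cost y (I i).

(* The infimum is a minimum: see [OPT_min]. *)
Definition OPT (R : realType) (n : nat) (I : profile R n) : R :=
  inf (range (fun y => SC y I)).

Definition mechanism (R : realType) (n : nat) := profile R n -> R.

Definition misreport (R : realType) (n : nat) (I : profile R n) (i : 'I_n)
    (b' : R) : profile R n :=
  [ffun j => if j == i then ((I i).1, b') else I j].

Definition strategyproof (R : realType) (n : nat) (B : R)
    (f : mechanism R n) :=
  forall I : profile R n, is_instance B I -> forall (i : 'I_n) (b' : R),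
    cost (f I) (I i) <= cost (f (misreport I i b')) (I i).

(* Extended-real valued, since the error may be unbounded. *)
Definition additive_error (R : realType) (n : nat) (B : R)
    (f : mechanism R n) : \bar R :=
  ereal_sup [set (SC (f I) I - OPT I)%:E | I in is_instance B].

Lemma costE (R : realType) (y : R) (a : R * R) :
  cost y a = `| `|y - a.1| - a.2 |.
Proof.
rewrite /cost; case: (leP y a.1) => h.
- by rewrite [`|y - a.1|]ler0_norm ?subr_le0//; congr `|_|; ring.
- by rewrite [`|y - a.1|]gtr0_norm ?subr_gt0// -normrN; congr `|_|; ring.
Qed.

Lemma SC_ge0 (R : realType) (n : nat) (y : R) (I : profile R n) : 0 <= SC y I.
Proof. by apply: sumr_ge0 => i _; rewrite costE. Qed.

Lemma SC_continuous (R : realType) (n : nat) (I : profile R n) :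
  continuous (fun y : R => SC y I).
Proof.
rewrite /SC => y; apply: cvg_big => [|i _]; first exact: add_continuous.
under eq_cvg do rewrite costE.
rewrite costE; apply: cvg_norm; apply: cvgB; last exact: cvg_cst.
by apply: cvg_norm; apply: cvgB; [exact: cvg_id | exact: cvg_cst].
Qed.

Lemma OPT_min (R : realType) (n : nat) (I : profile R n) :
  (exists y, SC y I = OPT I) /\ (forall y, OPT I <= SC y I).
Proof.
have lb y : OPT I <= SC y I.
  by apply: ge_inf; [exists 0 => _ [z _ <-]; exact: SC_ge0 | exists y].
suff [y hy] : exists y, forall z, SC y I <= SC z I.
  split=> //; exists y; apply/eqP; rewrite eq_le lb andbT.
  by apply: lb_le_inf; [exists (SC y I), y | move=> _ [z _ <-]; exact: hy].
case: n I lb => [|n] I _.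
  by exists 0 => z; rewrite /SC !big_ord0.
pose M := SC 0 I + `|(I ord0).1| + `|(I ord0).2|.
have M0 : 0 <= M by rewrite !addr_ge0 ?SC_ge0.
have [c _ hc] : exists2 c, c \in `[- M, M]%R &
    forall t, t \in `[- M, M]%R -> SC c I <= SC t I.
  apply: (@EVT_min R (fun y => SC y I)); first lra.
  exact/continuous_subspaceT/SC_continuous.
exists c => z; case: (leP `|z| M) => hz.
  by apply: hc; rewrite in_itv /= -ler_norml.
apply: (@le_trans _ _ (SC 0 I)); first by apply: hc; rewrite in_itv /=; lra.
apply: (@le_trans _ _ (cost z (I ord0))); last first.
  rewrite /SC big_ord_recl lerDl; apply: sumr_ge0 => i _.
  by rewrite costE.
rewrite costE.
have h1 := lerB_dist z (I ord0).1.
have h2 := ler_norm (I ord0).2.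
have h3 := ler_norm (`|z - (I ord0).1| - (I ord0).2).
rewrite /M in hz; lra.
Qed.

(* With one or two agents an exact strategy-proof mechanism exists, so a
   positive lower bound on the error requires at least three agents: agent 0
   dictates the candidates x_0 - b_0 and x_0 + b_0, and the last agent picks
   the one it prefers. *)
Lemma exact_mechanism_le2 (R : realType) (n : nat) (B : R) :
  (n < 2)%N -> exists f : mechanism R n.+1, strategyproof B f /\
    forall I, is_instance B I -> SC (f I) I = OPT I.
Proof.
move=> n2; pose l (I : profile R n.+1) := (I ord0).1 - (I ord0).2.
pose r (I : profile R n.+1) := (I ord0).1 + (I ord0).2.
pose f (I : profile R n.+1) :=
  if cost (l I) (I ord_max) <= cost (r I) (I ord_max) then l I else r I.
have c0 (I : profile R n.+1) : is_instance B I -> cost (f I) (I ord0) = 0.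
  move=> /(_ ord0)/andP[b0 _]; rewrite costE /f /l /r; case: ifP => _.
    by rewrite [X in `| `|X| - _ |](_ : _ = - (I ord0).2) ?normrN ?ger0_norm ?subrr ?normr0//; ring.
  by rewrite [X in `| `|X| - _ |](_ : _ = (I ord0).2) ?ger0_norm ?subrr ?normr0//; ring.
have lip (y z : R) a : cost z a <= cost y a + `|z - y|.
  rewrite !costE; have h1 := ler_dist_dist (z - a.1) (y - a.1).
  have h2 := ler_normD (`|y - a.1| - a.2) (`|z - a.1| - `|y - a.1|).
  rewrite [X in `|X| <= _](_ : _ = `|z - a.1| - a.2) in h2; last by ring.
  rewrite [X in _ <= `|X|](_ : _ = z - y) in h1; last by ring.
  lra.
have fmin I : cost (f I) (I ord_max) <= cost (l I) (I ord_max) /\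
    cost (f I) (I ord_max) <= cost (r I) (I ord_max).
  by rewrite /f; case: (leP (cost (l I) _)) => h; split; rewrite ?lexx ?(ltW h).
have fopt I y : cost (f I) (I ord_max) <= cost y (I ord0) + cost y (I ord_max).
  have [hl hr] := fmin I; rewrite addrC {3}/cost; case: (y <= _).
    exact: (le_trans hl (lip _ _ _)).
  exact: (le_trans hr (lip _ _ _)).
exists f; split=> [I hI i b'|I hI].
  have [->|i0] := eqVneq i ord0; first by rewrite c0 // costE.
  have im : i = ord_max.
    apply: val_inj => /=; have := ltn_ord i; have : (i != 0 :> nat)%N := i0.
    by case: (n) n2 (val i) => [|[|//]] _ [|[|k]].
  have [hl hr] := fmin I; rewrite im.
  have m0 : (misreport I ord_max b') ord0 = I ord0.
    by rewrite ffunE -im eq_sym (negbTE i0).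
  by rewrite {2}/f; case: ifP => _; rewrite ?/l ?/r m0.
have [_ lb] := OPT_min I; apply/eqP; rewrite eq_le lb andbT.
have [[y <-] _] := OPT_min I; rewrite /SC !big_ord_recl !c0 // add0r.
case: n n2 I hI lb y @l @r @f c0 fmin fopt => [|[|//]] _ I hI _ y l r f _ _ fopt.
  by rewrite !big_ord0 addr0 costE.
rewrite !big_ord1; have := fopt I y.
by rewrite (_ : ord_max = lift ord0 ord0) //; apply: val_inj.
Qed.

(* Main.v *)
(** Agents sharing a location and a preference can misreport one after the
    other, so each such group behaves like a single strategic agent.  Put [k]
    agents at [-B], [k] agents at [B] and at least [k] agents at [0], the last
    ones with preferred distance [B], where [k = n %/ 3].  When both outer groups
    report [0], the good locations are near [-B] and near [B]; by symmetry let
    the facility be on the nonnegative side.  If the true distance of the group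
    at [B] is [B / 2] instead, then only locations near [-B] are good.  This
    group prefers every reasonable nonnegative location to those, so it would
    report [0]. *)
Require Import Defs.
From HB Require Import structures.
From mathcomp Require Import all_boot all_order all_algebra.
From mathcomp Require Import all_classical all_reals all_analysis.
From mathcomp Require Import zify lra.
Import Order.TTheory GRing.Theory Num.Theory.
Local Open Scope ring_scope.

Definition group_misreport {R : realType} {n : nat} (I : profile R n)
    (s : seq 'I_n) (b' : R) : profile R n :=
  [ffun i => if i \in s then ((I i).1, b') else I i].

(** Induction on [s]: strategy-proofness is applied to [i] after the rest of the list has switched.
    That profile is an instance because [b'] obeys the bounds, and [uniq] ensures that [i] still
    reports [a] in it. *)
Lemma strategyproof_group {R : realType} {n : nat} {B : R}
    {f : mechanism R n} (hf : strategyproof B f) (I : profile R n)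
    (s : seq 'I_n) (a : R * R) (b' : R) :
  is_instance B I -> 0 <= b' <= B -> uniq s -> {in s, forall i, I i = a} ->
  cost (f I) a <= cost (f (group_misreport I s b')) a.
Proof.
move=> hI hb'; elim: s => [|i s IHs] /=.
  move=> _ _; rewrite (_ : group_misreport I [::] b' = I) //.
  by apply/ffunP => i; rewrite ffunE.
move=> /andP[si us] Ia; apply: le_trans (IHs us _) _.
  by move=> j js; apply: Ia; rewrite in_cons js orbT.
have hJ : is_instance B (group_misreport I s b').
  by move=> j; rewrite ffunE; case: ifP.
have := hf _ hJ i b'; rewrite ffunE (negbTE si) Ia ?mem_head //.
congr (_ <= cost (f _) _); apply/ffunP => j.
by rewrite !ffunE in_cons; case: eqVneq => [->|//]; rewrite (negbTE si).
Qed.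

Definition three_groups {R : realType} (n k : nat) (B bl br : R) :
    profile R n :=
  [ffun i : 'I_n => if (i < k)%N then (- B, bl)
                    else if (i < k + k)%N then (B, br) else (0, B)].

Lemma is_instance_three_groups {R : realType} {n k : nat} {B bl br : R} :
  0 <= bl <= B -> 0 <= br <= B -> is_instance B (three_groups n k B bl br).
Proof.
move=> hl hr i; rewrite ffunE; case: ifP => // _; case: ifP => // _ /=.
by case/andP: hl => /le_trans h /h ->; rewrite lexx.
Qed.

Lemma SC_three_groups {R : realType} {n k : nat} (B bl br y : R) :
  (k + k <= n)%N ->
  SC y (three_groups n k B bl br) =
  cost y (- B, bl) *+ k + cost y (B, br) *+ k + cost y (0, B) *+ (n - (k + k)).
Proof.
move=> hk; rewrite /SC.
under eq_bigr do rewrite ffunE.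
rewrite -(big_mkord xpredT (fun i => cost y (if (i < k)%N then (- B, bl)
  else if (i < k + k)%N then (B, br) else (0, B)))).
rewrite (@big_cat_nat _ _ _ (k + k)%N) //= (@big_cat_nat _ _ _ k) ?leq_addr //=.
congr (_ + _ + _).
- rewrite -[X in _ *+ X]subn0 -sumr_const_nat; apply: eq_big_nat => i /andP[_ ik].
  by rewrite ik.
- rewrite -[X in _ *+ X](addnK k) -sumr_const_nat.
  by apply: eq_big_nat => i /andP[ki ik]; rewrite ltnNge ki ik.
- rewrite -sumr_const_nat; apply: eq_big_nat => i /andP[ki _].
  by rewrite !ltnNge ki (leq_trans (leq_addr _ _) ki).
Qed.

Lemma cost_ge0 {R : realType} (y : R) (a : R * R) : 0 <= cost y a.
Proof. by rewrite costE. Qed.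

Lemma costN {R : realType} (y x b : R) : cost (- y) (- x, b) = cost y (x, b).
Proof. by rewrite !costE /= -opprD normrN. Qed.

Lemma SC_three_groupsN {R : realType} {n k : nat} (B bl br y : R) :
  (k + k <= n)%N ->
  SC (- y) (three_groups n k B br bl) = SC y (three_groups n k B bl br).
Proof.
move=> hk; rewrite !SC_three_groups // costN.
have -> : cost (- y) (B, bl) = cost y (- B, bl) by rewrite -costN opprK.
have -> : cost (- y) (0, B) = cost y (0, B) by rewrite -costN opprK oppr0.
by rewrite [X in X + _]addrC.
Qed.

(** Form [k] triples with one agent from each group; each triple saves [B / 4] at [w]. The leftover
    agents all sit at [0], where they pay nothing under [w]. *)
Lemma SC_three_groups_gap {R : realType} {n k : nat} {B bl br w y : R} :
  (3 * k <= n)%N -> cost w (0, B) = 0 ->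
  cost w (- B, bl) + cost w (B, br) + B / 4
    <= cost y (- B, bl) + cost y (B, br) + cost y (0, B) ->
  SC w (three_groups n k B bl br) + k%:R * B / 4
    <= SC y (three_groups n k B bl br).
Proof.
move=> hk w0 h; rewrite !SC_three_groups; try lia.
have -> : (n - (k + k) = k + (n - 3 * k))%N by lia.
rewrite w0 mul0rn addr0 -mulrA mulr_natl mulrnDr addrA -!mulrnDl.
by apply: ler_wpDr; [exact/mulrn_wge0/cost_ge0 | exact: ler_wMn2r].
Qed.

Lemma cost_peakl {R : realType} {x b : R} : 0 <= b -> cost (x - b) (x, b) = 0.
Proof.
move=> hb; rewrite costE /= addrAC subrr sub0r normrN [`|b|]ger0_norm //.
by rewrite subrr normr0.
Qed.

Lemma cost_peakr {R : realType} {x b : R} : 0 <= b -> cost (x + b) (x, b) = 0.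
Proof. by move=> hb; rewrite -costN opprD cost_peakl. Qed.

(** A triple costs [3 / 2 * B] at [- B]. On [[- B, 0]] it costs [z + 5 / 2 * B], so the excess
    reaches [B / 4] exactly at [- (3 / 4 * B)]; for nonnegative [z] it costs at least [2 * B]. *)
Lemma gap_half {R : realType} {n k : nat} {B z : R} :
  0 <= B -> (3 * k <= n)%N -> - (3 / 4 * B) <= z ->
  SC (- B) (three_groups n k B 0 (B / 2)) + k%:R * B / 4
    <= SC z (three_groups n k B 0 (B / 2)).
Proof.
move=> hB hk hz; apply: SC_three_groups_gap => //.
  by rewrite -[- B]sub0r cost_peakl.
rewrite -{1}[- B]subr0 cost_peakl // add0r.
have -> : cost (- B) (B, B / 2) = 3 / 2 * B.
  by rewrite /cost /= ifT ?ger0_norm; lra.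
rewrite /cost /=; case: (leP z (- B)) => zB.
  (* Only possible when [B = 0]. *)
  by rewrite !ifT; do ?[case: ler0P => ?]; lra.
rewrite [`|- B + 0 - z|]ler0_norm; last lra.
case: (leP z 0) => z0; first by rewrite ifT; do ?[case: ler0P => ?]; lra.
by case: (leP z B) => ?; do ![case: ler0P => ?]; lra.
Qed.

(** A nonnegative location that is this bad for the right group lies far beyond [B]. There the agent
    at [- B] alone pays at least [15 / 4 * B], while a whole triple costs [2 * B] at [B]. *)
Lemma gap_zero {R : realType} {n k : nat} {B y : R} :
  0 <= B -> (3 * k <= n)%N -> 0 <= y -> 5 / 4 * B <= cost y (B, B / 2) ->
  SC B (three_groups n k B 0 0) + k%:R * B / 4
    <= SC y (three_groups n k B 0 0).
Proof.
move=> hB hk y0 hc.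
have yB : 11 / 4 * B <= y.
  by move: hc; rewrite /cost /=; case: (leP y B) => ?; case: ler0P => ?; lra.
apply: SC_three_groups_gap => //; first by rewrite -{1}[B]add0r cost_peakr.
rewrite -{3}[B]addr0 cost_peakr // addr0.
have -> : cost B (- B, 0) = 2 * B.
  by rewrite costE /= subr0 opprK normr_id ger0_norm; lra.
have := cost_ge0 y (B, 0); have := cost_ge0 y (0, B).
by rewrite [cost y (- B, 0)]costE /= subr0 normr_id ger0_norm; lra.
Qed.

Lemma half_cost_far {R : realType} {B z : R} :
  0 <= B -> z <= - (3 / 4 * B) -> 5 / 4 * B <= cost z (B, B / 2).
Proof. by move=> hB hz; rewrite /cost /= ifT ?ger0_norm; lra. Qed.

Theorem theorem1 (R : realType) (n : nat) (B : R)
    (hn : (3 <= n)%N) (hB : 0 <= B) (f : mechanism R n)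
    (hf : strategyproof B f) :
  ((n%:R * B / 24)%:E <= additive_error B f)%E /\
  exists I : profile R n,
    is_instance B I /\ OPT I + n%:R * B / 24 <= SC (f I) I.
Proof.
suff [I [hI hS]] : exists I : profile R n,
    is_instance B I /\ OPT I + n%:R * B / 24 <= SC (f I) I.
  split; last by exists I.
  apply: le_trans (ereal_sup_ubound (imageP _ hI)).
  by rewrite lee_fin lerBrDl.
apply: contrapT => no_bad.
pose k := (n %/ 3)%N; pose T := three_groups n k B.
have hk : (3 * k <= n)%N by rewrite /k; lia.
have hk2 : (k + k <= n)%N by lia.
(* Since [1 <= k], [n <= 3 * k + 2 <= 5 * k], and [5 / 24 <= 1 / 4]. *)
have nk : n%:R * B / 24 <= k%:R * B / 4.
  have : (n%:R : R) <= 5 * k%:R by rewrite -natrM ler_nat /k; lia.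
  by move=> /(ler_wpM2r hB); have := mulr_ge0 (ler0n R k) hB; lra.
(* Without a bad instance, no location beats the output by [k%:R * B / 4]; both gap lemmas are
   played against this. *)
have near_opt I w : is_instance B I -> SC (f I) I < SC w I + k%:R * B / 4.
  move=> hI; rewrite ltNge; apply/negP => h; apply: no_bad; exists I; split=> //.
  by have [_ /(_ w)] := OPT_min I; lra.
have b0 : 0 <= (0 : R) <= B by rewrite lexx.
have b2 : 0 <= B / 2 <= B by apply/andP; split; lra.
have uG (P : pred 'I_n) : uniq (enum P) by exact: enum_uniq.
have [y0|y0] := leP 0 (f (T 0 0)).
  have hI := is_instance_three_groups (n := n) (k := k) b0 b2.
  have hz : f (T 0 (B / 2)) <= - (3 / 4 * B).
    rewrite leNgt; apply/negP => /ltW/(gap_half hB hk).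
    by rewrite leNgt near_opt.
  pose G := [pred i : 'I_n | (k <= i < k + k)%N].
  have hG : {in enum G, forall i, T 0 (B / 2) i = (B, B / 2)}.
    move=> i; rewrite mem_enum inE ffunE => /andP[ki ik].
    by rewrite ltnNge ki ik.
  have := strategyproof_group hf _ (enum G) _ 0 hI b0 (uG G) hG.
  rewrite (_ : group_misreport _ _ _ = T 0 0); last first.
    apply/ffunP => i; rewrite !ffunE mem_enum inE.
    by case: ltnP => //= _; case: ltnP.
  move=> /(le_trans (half_cost_far hB hz))/(gap_zero hB hk y0).
  by rewrite leNgt near_opt //; exact: is_instance_three_groups.
(* Mirror case: the left group deviates, and the same bounds apply to the negated outputs. The
   profile [T 0 0] is its own reflection. *)
have hI := is_instance_three_groups (n := n) (k := k) b2 b0.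
have hz : - f (T (B / 2) 0) <= - (3 / 4 * B).
  rewrite leNgt; apply/negP => /ltW/(gap_half hB hk).
  by rewrite !SC_three_groupsN // leNgt near_opt.
pose G := [pred i : 'I_n | (i < k)%N].
have hG : {in enum G, forall i, T (B / 2) 0 i = (- B, B / 2)}.
  by move=> i; rewrite mem_enum inE ffunE => ->.
have := strategyproof_group hf _ (enum G) _ 0 hI b0 (uG G) hG.
rewrite (_ : group_misreport _ _ _ = T 0 0); last first.
  by apply/ffunP => i; rewrite !ffunE mem_enum inE; case: ltnP.
have Ny0 : 0 <= - f (T 0 0) by rewrite oppr_ge0 ltW.
(* Costs of the left group become costs of the right group at the reflected locations. *)
rewrite -![cost _ (- B, _)]costN opprK.
move=> /(le_trans (half_cost_far hB hz))/(gap_zero hB hk Ny0).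
rewrite SC_three_groupsN // leNgt near_opt //.
exact: is_instance_three_groups.
Qed.
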